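(* Let $m$ and $r$ be non-negative integers. If $\{(s_k),(\sigma_k)\}$, $k=0,1,2,\ldots$, is a binomial-transform pair of the first kind, then so is the pair of sequences \[ a_k=\sum_{p=0}^r(-1)^p\binom rp s_{k+p+m},\qquad \alpha_k=\sum_{p=0}^m(-1)^p\binom mp\sigma_{k+p+r},\qquad k=0,1,2,\ldots; \] thus, for every non-negative integer $n$, \[ \sum_{k=0}^n(-1)^k\binom nk\sum_{p=0}^r(-1)^p\binom rp s_{k+p+m}=\sum_{k=0}^m(-1)^k\binom mk\sigma_{n+k+r}. \]
   Context: Two sequences $(s_k)_{k\ge0}$ and $(\sigma_k)_{k\ge0}$ of complex numbers form a binomial-transform pair of the first kind if $\sigma_n=\sum_{k=0}^n(-1)^k\binom nk s_k$ for every non-negative integer $n$. *)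

(* Defs.v *)
From HB Require Import structures.
From mathcomp Require Import all_boot all_order all_algebra.
From mathcomp Require Import complex.
From mathcomp Require Import reals.

Set Implicit Arguments.
Unset Strict Implicit.
Unset Printing Implicit Defensive.

Import GRing.Theory.
Local Open Scope ring_scope.

(* An ordered pair: sigma is the transform of s.  R[i] is the field of complex numbers, as a realType is
   a complete Archimedean ordered field. *)
Definition binomial_pair1 (R : realType) (s sigma : nat -> R[i]) : Prop :=
  forall n : nat,
    sigma n = \sum_(0 <= k < n.+1) (-1) ^+ k * 'C(n, k)%:R * s k.

(* Main.v *)
(* Write T_n f = \sum_k (-1)^k 'C(n, k) f k and let S be the shift. Pascal's rule
   reads T_(n+1) f = T_n f - T_n (S f), i.e. T_n f = ((1 - S)^n f) 0. Hence
   differencing f r times raises n by r, and, since S = 1 - (1 - S), shifting f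
   m times amounts to differencing the sequence n |-> T_n f m times. *)
Require Import Defs.
From HB Require Import structures.
From mathcomp Require Import all_boot all_order all_algebra.
From mathcomp Require Import complex.
From mathcomp Require Import reals.

Set Implicit Arguments.
Unset Strict Implicit.
Unset Printing Implicit Defensive.

Import GRing.Theory.
Local Open Scope ring_scope.

(** This is [T_n f]. One operator covers both the transform and the iterated differences of [s] and
    [sigma]. *)
Definition binomial_sum (A : pzRingType) (n : nat) (f : nat -> A) : A :=
  \sum_(0 <= k < n.+1) (-1) ^+ k * 'C(n, k)%:R * f k.

Section BinomialSum.
Variable A : pzRingType.
Implicit Types f g : nat -> A.

Lemma eq_binomial_sum n f g : f =1 g -> binomial_sum n f = binomial_sum n g.
Proof. by move=> fg; apply: eq_bigr => k _; rewrite fg. Qed.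

Lemma binomial_sumB n f g :
  binomial_sum n (fun k => f k - g k) = binomial_sum n f - binomial_sum n g.
Proof. by rewrite /binomial_sum -sumrB; apply: eq_bigr => k _; rewrite mulrBr. Qed.

Lemma binomial_sumS n f :
  binomial_sum n.+1 f = binomial_sum n f - binomial_sum n (fun k => f k.+1).
Proof.
(* The added term vanishes, as ['C(n, n.+1)] is 0. With equal ranges, the [k = 0] terms cancel and
   Pascal's rule applies to the rest. *)
have extend : binomial_sum n f =
    \sum_(0 <= k < n.+2) (-1) ^+ k * 'C(n, k)%:R * f k.
  by rewrite big_nat_recr //= bin_small // mulr0 mul0r addr0.
rewrite extend /binomial_sum !(big_nat_recl n.+1) //= !bin0 -addrA -sumrB.
congr (_ + _); apply: eq_bigr => k _.
by rewrite binS natrD mulrDr mulrDl; congr (_ + _); rewrite exprS mulN1r !mulNr.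
Qed.

(** The inner sum is ((1 - S)^r f) k, so the exponents of 1 - S add up. *)
Lemma binomial_sum_diff n r f :
  binomial_sum n (fun k => binomial_sum r (fun p => f (k + p)%N)) =
  binomial_sum (n + r) f.
Proof.
elim: r f => [|r IHr] f.
  rewrite addn0; apply: eq_binomial_sum => k.
  by rewrite /binomial_sum big_nat1 bin0 !mul1r addn0.
rewrite addnS binomial_sumS -!IHr -binomial_sumB.
apply: eq_binomial_sum => k; rewrite binomial_sumS; congr (_ - _).
by apply: eq_binomial_sum => p; rewrite addnS.
Qed.

(** Expand S^m = (1 - (1 - S))^m by the binomial theorem; each factor 1 - S raises the index of T by
    one. *)
Lemma binomial_sum_shift n m f :
  binomial_sum n (fun k => f (k + m)%N) =
  binomial_sum m (fun k => binomial_sum (n + k) f).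
Proof.
elim: m f => [|m IHm] f.
  rewrite {2}/binomial_sum big_nat1 bin0 !mul1r addn0.
  by apply: eq_binomial_sum => k; rewrite addn0.
rewrite binomial_sumS -binomial_sumB.
rewrite (eq_binomial_sum n (g := fun k => f (k + m).+1)); last first.
  by move=> k; rewrite addnS.
(* One shift is absorbed into [f]; Pascal's rule in the form T_j (S f) = T_j f - T_(j+1) f, with j =
   [n + k], then closes the step. *)
rewrite (IHm (fun k => f k.+1)); apply: eq_binomial_sum => k.
by rewrite addnS binomial_sumS opprB addrC subrK.
Qed.

End BinomialSum.

Theorem theorem12 (R : realType) (m r : nat) (s sigma : nat -> R[i])
  (hs : binomial_pair1 s sigma) :
  binomial_pair1
    (fun k => \sum_(0 <= p < r.+1) (-1) ^+ p * 'C(r, p)%:R * s (k + p + m)%N)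
    (fun k => \sum_(0 <= p < m.+1) (-1) ^+ p * 'C(m, p)%:R * sigma (k + p + r)%N)
  /\
  (forall n : nat,
    \sum_(0 <= k < n.+1) (-1) ^+ k * 'C(n, k)%:R *
      (\sum_(0 <= p < r.+1) (-1) ^+ p * 'C(r, p)%:R * s (k + p + m)%N)
    = \sum_(0 <= k < m.+1) (-1) ^+ k * 'C(m, k)%:R * sigma (n + k + r)%N).
Proof.
suff transform n :
    binomial_sum n (fun k => binomial_sum r (fun p => s (k + p + m)%N)) =
    binomial_sum m (fun k => sigma (n + k + r)%N).
  by split=> n; [rewrite -[RHS]/(binomial_sum n _) transform | exact: transform].
(* First the r differences raise [n] to [n + r], then the shift by [m] becomes m differences of T_j
   s in j, starting at [n + r]. *)
rewrite (binomial_sum_diff n r (fun k => s (k + m)%N)) binomial_sum_shift.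
by apply: eq_binomial_sum => k; rewrite hs addnAC.
Qed.
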